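(* Let $\sigma,\hat\sigma:\mathbb{R}\to(0,\infty)$ be two continuous diffusion coefficients with $\hat\sigma(x)>\sigma(x)$ for all $x\in\mathbb{R}$, and let $\mu,c,q_u,q_d$ be the same in both models. Let $(a^\ast,b^\ast)$, $\lambda^\ast$ and $v$ be the optimal boundaries, minimal long run average cost and value function for the model with coefficient $\sigma$, and let $(\check a,\check b)$, $\hat\lambda$ be the optimal boundaries and minimal long run average cost for the model with coefficient $\hat\sigma$. Assume that $v$ is convex. Then increased volatility expands the continuation region and increases the expected long run average costs: $$\check a<a^\ast,\qquad \check b>b^\ast,\qquad \hat\lambda>\lambda^\ast .$$
   Context: Setting. $\mu:\mathbb{R}\to\mathbb{R}$ is continuous; diffusion coefficients $\sigma$ are continuous with $\sigma^2>0$ on $\mathbb{R}$, and $(1+|\mu|)/\sigma^2$ is locally integrable. For a diffusion coefficient $\sigma$: $\mathcal{A}=\frac12\sigma^2(x)\frac{d^2}{dx^2}+\mu(x)\frac{d}{dx}$, $S'(x)=\exp\left(-\int_{x_0}^x\frac{2\mu(y)}{\sigma^2(y)}dy\right)$ (arbitrary fixed $x_0$), $m'(x)=\frac{2}{\sigma^2(x)S'(x)}$, $m(a,b)=\int_a^b m'(t)\,dt$. Costs. $c:\mathbb{R}\to[0,\infty)$ is continuous with $c(x)\ge c(0)\ge0$; $q_u,q_d\ge0$ are constants with $q_u+q_d>0$. Put $\pi_1(x)=c(x)+q_d\mu(x)$, $\pi_2(x)=c(x)-q_u\mu(x)$. Standing assumptions: (i) for $i=1,2$ there is a unique minimizer $\hat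 x_i\in\mathbb{R}$ of $\pi_i$, and $\pi_i$ is strictly decreasing on $(-\infty,\hat x_i)$ and strictly increasing on $(\hat x_i,\infty)$; (ii) $\lim_{x\uparrow\infty}\pi_1(x)=\lim_{x\downarrow-\infty}\pi_2(x)=\infty$. For each diffusion coefficient, the expected long-run average cost of reflecting the diffusion at $a<b$ (unit cost $q_u$ for pushing up at $a$, $q_d$ for pushing down at $b$, running cost $c$) is $$C(a,b)=\frac{1}{m(a,b)}\left[\int_a^b c(t)m'(t)\,dt+\frac{q_u}{S'(a)}+\frac{q_d}{S'(b)}\right].$$ The optimal boundaries $(a^\ast,b^\ast)$ are the unique global minimizer of $C$ over $a<b$; equivalently the unique solution $a<b$ of $C(a,b)=\pi_2(a)=\pi_1(b)$. They lie in $(-\infty,\hat x_2)\times(\hat x_1,\infty)$. The minimal long run average cost is $\lambda^\ast=C(a^\ast,b^\ast)$. The continuation region is $(a^\ast,b^\ast)$. The value $v$ is the $C^2(\mathbb{R})$ function (unique up to an additive constant) with $(\mathcal{A}v)(x)+c(x)=\lambda^\ast$ on $(a^\ast,b^\ast)$, $v(x)=q_d(x-b^\ast)+v(b^\ast)$ for $x\ge b^\ast$, $v(x)=q_u(a^\ast-x)+v(a^\ast)$ for $x\le a^\ast$; it satisfies $-q_u\le v'\le q_d$. *)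

(* Defs.v *)
From Stdlib Require Import Reals.
From Coquelicot Require Import Coquelicot.

Open Scope R_scope.

(** * One-dimensional diffusions *)

(* Since [mu] and [sigma] are continuous and [sigma] does not vanish, Riemann
   integrability on compact intervals is local integrability here (and the
   last field follows from the others). *)
Record diffusion_coefficient (mu sigma : R -> R) : Prop := {
  sigma_continuous : forall x, continuous sigma x;
  sigma_pos : forall x, 0 < sigma x;
  sigma_loc_integrable :
    forall a b, ex_RInt (fun x => (1 + Rabs (mu x)) / sigma x ^ 2) a b
}.

Definition generator (mu sigma v : R -> R) (x : R) : R :=
  1 / 2 * sigma x ^ 2 * Derive_n v 2 x + mu x * Derive v x.

(* [x0] is the arbitrary base point; [avg_cost] below does not depend on it. *)
Definition scale_density (mu sigma : R -> R) (x0 x : R) : R :=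
  exp (- RInt (fun y => 2 * mu y / sigma y ^ 2) x0 x).

Definition speed_density (mu sigma : R -> R) (x0 x : R) : R :=
  2 / (sigma x ^ 2 * scale_density mu sigma x0 x).

Definition speed_measure (mu sigma : R -> R) (x0 a b : R) : R :=
  RInt (speed_density mu sigma x0) a b.

(** * Costs *)

Definition pi1 (mu c : R -> R) (qd x : R) : R := c x + qd * mu x.

Definition pi2 (mu c : R -> R) (qu x : R) : R := c x - qu * mu x.

Definition minimizer (f : R -> R) (x : R) : Prop := forall y, f x <= f y.

Record unimodal_at (f : R -> R) (xh : R) : Prop := {
  unimodal_min : unique (minimizer f) xh;
  unimodal_decr : forall x y, x < y -> y < xh -> f y < f x;
  unimodal_incr : forall x y, xh < x -> x < y -> f x < f y
}.

Record standing_assumptions (mu c : R -> R) (qu qd : R) : Prop := {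
  mu_continuous : forall x, continuous mu x;
  c_continuous : forall x, continuous c x;
  c_min : forall x, c 0 <= c x;
  c0_nonneg : 0 <= c 0;
  qu_nonneg : 0 <= qu;
  qd_nonneg : 0 <= qd;
  qu_qd_pos : 0 < qu + qd;
  pi1_unimodal : exists xh1, unimodal_at (pi1 mu c qd) xh1;
  pi2_unimodal : exists xh2, unimodal_at (pi2 mu c qu) xh2;
  pi1_lim : is_lim (pi1 mu c qd) p_infty p_infty;
  pi2_lim : is_lim (pi2 mu c qu) m_infty p_infty
}.

(** * Ergodic control by reflection *)

(* Expected long-run average cost of reflecting the diffusion at [a < b]. *)
Definition avg_cost (mu sigma c : R -> R) (qu qd x0 a b : R) : R :=
  / speed_measure mu sigma x0 a b *
  (RInt (fun t => c t * speed_density mu sigma x0 t) a b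
   + qu / scale_density mu sigma x0 a
   + qd / scale_density mu sigma x0 b).

(* Global minimality only: uniqueness of the minimizer is a consequence of
   [standing_assumptions] and is not built into the definition. *)
Definition optimal_boundaries (mu sigma c : R -> R) (qu qd x0 a b : R) : Prop :=
  a < b /\
  forall a' b', a' < b' ->
    avg_cost mu sigma c qu qd x0 a b <= avg_cost mu sigma c qu qd x0 a' b'.

Definition C2 (v : R -> R) : Prop :=
  forall x, ex_derive v x /\ ex_derive (Derive v) x /\
            continuous (Derive_n v 2) x.

Record value_function (mu sigma c : R -> R) (qu qd a b lambda : R)
    (v : R -> R) : Prop := {
  value_C2 : C2 v;
  value_ode : forall x, a < x < b -> generator mu sigma v x + c x = lambda;
  value_right : forall x, b <= x -> v x = qd * (x - b) + v b;
  value_left : forall x, x <= a -> v x = qu * (a - x) + v a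
}.

Definition convex (f : R -> R) : Prop :=
  forall x y t, 0 <= t <= 1 ->
    f (t * x + (1 - t) * y) <= t * f x + (1 - t) * f y.

(* Main.v *)
(** Since [1 / S'] has derivative [mu m'], the excess
    [int_a^b (c - l) m' + q_u / S'(a) + q_d / S'(b)] of the cost over the rate
    [l] changes by the integral of [(pi_1 - l) m'] when [b] moves, and of
    [(pi_2 - l) m'] when [a] moves.  As the excess over the optimal rate is
    minimal (and zero) at the optimal boundaries, these satisfy
    [pi_1(b) = pi_2(a) = l] and lie on the increasing branch of [pi_1], resp.
    the decreasing branch of [pi_2]; hence it suffices to compare the rates.
    A convex [v] satisfies [A^ v + c - lambda >= (sigma^ ^2 - sigma^2) v'' / 2]
    on the whole line and [-q_u <= v' <= q_d].  As [A^ v] is the derivative of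
    [v' / S^'] with respect to [m^], integrating over the optimal interval of
    the second model bounds its excess over [lambda] from below by a positive
    combination of [v'(b) - v'(a)], [q_d - v'(b)] and [q_u + v'(a)]; these are
    nonnegative and sum to [q_u + q_d > 0]. *)

Require Import Defs.
From Stdlib Require Import Reals Lra.
From Coquelicot Require Import Coquelicot.

Open Scope R_scope.

(** * Calculus for integrals of continuous functions *)

Lemma ex_RInt_cont (f : R -> R) (a b : R) :
  (forall x, continuous f x) -> ex_RInt f a b.
Proof. intros Hf. apply (ex_RInt_continuous (V := R_CompleteNormedModule)). intros z _. apply Hf. Qed.

Lemma RInt_plus_cont (f g : R -> R) (a b : R) :
  (forall x, continuous f x) -> (forall x, continuous g x) ->
  RInt (fun t => f t + g t) a b = RInt f a b + RInt g a b :> R.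
Proof.
intros Hf Hg.
apply (RInt_plus (V := R_CompleteNormedModule)); now apply ex_RInt_cont.
Qed.

Lemma RInt_scal_cont (k : R) (f : R -> R) (a b : R) :
  (forall x, continuous f x) ->
  RInt (fun t => k * f t) a b = k * RInt f a b :> R.
Proof.
intros Hf. apply (RInt_scal (V := R_CompleteNormedModule)).
now apply ex_RInt_cont.
Qed.

Lemma RInt_Chasles_cont (f : R -> R) (a b c : R) :
  (forall x, continuous f x) -> RInt f a b + RInt f b c = RInt f a c :> R.
Proof.
intros Hf.
apply (RInt_Chasles (V := R_CompleteNormedModule)); now apply ex_RInt_cont.
Qed.

Lemma is_derive_RInt_cont (f : R -> R) (a x : R) :
  (forall x, continuous f x) -> is_derive (RInt f a) x (f x).
Proof.
intros Hf. apply (is_derive_RInt f _ a).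
- apply filter_forall. intros y. apply (RInt_correct (V := R_CompleteNormedModule)), ex_RInt_cont, Hf.
- apply Hf.
Qed.

Lemma RInt_is_derive (F f : R -> R) (a b : R) :
  (forall x, is_derive F x (f x)) -> (forall x, continuous f x) ->
  RInt f a b = F b - F a :> R.
Proof.
intros HF Hf. apply (is_RInt_unique (V := R_CompleteNormedModule)).
apply (is_RInt_derive F f a b); intros; [apply HF | apply Hf].
Qed.

(** * First-order conditions and one-sided limits of inequalities *)

Lemma is_derive_local_min (f : R -> R) (x l d : R) :
  0 < d -> is_derive f x l -> (forall y, Rabs (y - x) < d -> f x <= f y) ->
  l = 0.
Proof.
intros Hd Hf Hmin. apply is_derive_Reals in Hf.
rewrite <- (deriv_minimum f (x - d) (x + d) x (exist _ l Hf)); try lra.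
- reflexivity.
- intros y H1 H2. apply Hmin, Rabs_def1; lra.
Qed.

Lemma is_derive_ge_0_right (f : R -> R) (x l d : R) :
  0 < d -> is_derive f x l -> (forall y, x <= y <= x + d -> f x <= f y) ->
  0 <= l.
Proof.
intros Hd Hf Hmin. apply is_derive_Reals in Hf.
destruct (Rle_or_lt 0 l) as [|Hl]; [assumption|exfalso].
(* Tolerance [- l] keeps the difference quotient strictly below [l + (- l) = 0]. *)
destruct (Hf (- l) ltac:(lra)) as [[e He] H]; simpl in H.
set (h := Rmin d (e / 2)).
assert (Hh : 0 < h <= d /\ h <= e / 2).
{ unfold h. repeat split; [apply Rmin_glb_lt; lra | apply Rmin_l | apply Rmin_r]. }
assert (Hlt := H h ltac:(lra) ltac:(rewrite Rabs_pos_eq; lra)).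
apply Rabs_def2 in Hlt.
assert (Hq : 0 <= (f (x + h) - f x) / h).
{ apply Rdiv_le_0_compat; [|lra]. specialize (Hmin (x + h) ltac:(lra)). lra. }
lra.
Qed.

(** A negative value at [x] would persist on a neighbourhood, hence at some point right of [x]. This
    carries inequalities known strictly outside the continuation region to its endpoints. *)
Lemma continuous_ge_0_right (f : R -> R) (x : R) :
  continuous f x -> (forall y, x < y -> 0 <= f y) -> 0 <= f x.
Proof.
intros Hf Hpos. destruct (Rle_or_lt 0 (f x)) as [|Hx]; [assumption|exfalso].
destruct (Hf _ (open_lt 0 (f x) Hx)) as [[e He] H].
specialize (H (x + e / 2)). specialize (Hpos (x + e / 2) ltac:(lra)).
cut (f (x + e / 2) < 0); [lra|]. apply H.
apply Rabs_def1; unfold minus, plus, opp; simpl; lra.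
Qed.

Lemma continuous_reflect (f : R -> R) (x : R) :
  continuous f (- x) -> continuous (fun t => f (- t)) x.
Proof.
intros Hf. apply (continuous_comp Ropp f); [|exact Hf].
apply (continuous_opp (fun t : R => t)), continuous_id.
Qed.

Lemma continuous_ge_0_left (f : R -> R) (x : R) :
  continuous f x -> (forall y, y < x -> 0 <= f y) -> 0 <= f x.
Proof.
intros Hf Hpos. rewrite <- (Ropp_involutive x).
apply (continuous_ge_0_right (fun y => f (- y))).
- apply continuous_reflect. now rewrite Ropp_involutive.
- intros y Hy. apply Hpos. lra.
Qed.

(** * Differentiable convex functions *)

Section Convex.

Variable v : R -> R.
Hypothesis v_derive : forall x, ex_derive v x.
Hypothesis v_convex : convex v.

(** Along the segment from [x] to [y], chord minus graph is nonnegative and vanishes at parameter 0,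
    so its derivative there is nonnegative; that derivative is the claimed gap. *)
Lemma convex_tangent (x y : R) : v x + Derive v x * (y - x) <= v y.
Proof.
cut (0 <= (v y - v x) - Derive v x * (y - x)); [lra|].
apply (is_derive_ge_0_right
  (fun t => t * (v y - v x) - v (x + t * (y - x))) 0 _ 1); [lra| |].
- auto_derive.
  + apply v_derive.
  + rewrite Rmult_0_l, Rplus_0_r. rewrite (Derive_ext _ v); [ring|reflexivity].
- intros t Ht. rewrite !Rmult_0_l, Rplus_0_r.
  assert (H := v_convex y x t ltac:(lra)).
  replace (x + t * (y - x)) with (t * y + (1 - t) * x) by ring. lra.
Qed.

Lemma convex_Derive_incr (x y : R) : x <= y -> Derive v x <= Derive v y.
Proof.
intros [Hxy | ->]; [|lra].
(* Adding the two tangent inequalities cancels the values of [v]. *)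
assert (H1 := convex_tangent x y). assert (H2 := convex_tangent y x).
apply (Rmult_le_reg_r (y - x)); lra.
Qed.

Lemma convex_Derive2_ge_0 (x : R) :
  ex_derive (Derive v) x -> 0 <= Derive_n v 2 x.
Proof.
intros H. apply (is_derive_ge_0_right (Derive v) x _ 1); [lra| |].
- apply (Derive_correct (Derive v) x H).
- intros y Hy. apply convex_Derive_incr. lra.
Qed.

End Convex.

(** * Unimodal functions and local extrema of weighted integrals *)

Lemma unimodal_le_right (f : R -> R) (xh x y : R) :
  unimodal_at f xh -> xh <= x -> x <= y -> f x <= f y.
Proof.
(* Monotonicity is given only strictly beyond [xh]; at [xh] itself minimality takes over. *)
intros Hf [Hx | <-] Hy; [|apply (proj1 (unimodal_min _ _ Hf))].
destruct Hy as [Hy | ->]; [|lra].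
apply Rlt_le, (unimodal_incr _ _ Hf); assumption.
Qed.

Lemma unimodal_le_left (f : R -> R) (xh x y : R) :
  unimodal_at f xh -> y <= xh -> x <= y -> f y <= f x.
Proof.
intros Hf [Hy | ->] Hx; [|apply (proj1 (unimodal_min _ _ Hf))].
destruct Hx as [Hx | ->]; [|lra].
apply Rlt_le, (unimodal_decr _ _ Hf); assumption.
Qed.

Section LocalOptimum.

Variables (f p : R -> R) (l x xh d : R).
Hypothesis f_continuous : forall t, continuous f t.
Hypothesis p_continuous : forall t, continuous p t.
Hypothesis p_pos : forall t, 0 < p t.
Hypothesis f_unimodal : unimodal_at f xh.
Hypothesis d_pos : 0 < d.

Let g t := (f t - l) * p t.

Lemma weighted_gap_continuous (t : R) : continuous g t.
Proof.
apply (continuous_mult (fun t => f t - l) p); [|apply p_continuous].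
apply (continuous_minus f (fun _ => l)); [apply f_continuous|].
apply continuous_const.
Qed.

(** The integral from [x] to [y] vanishes at [y = x], so it has a local minimum there and its
    derivative [g x] is zero; the weight is positive. *)
Lemma RInt_local_min_eq :
  (forall y, Rabs (y - x) < d -> 0 <= RInt g x y) -> f x = l.
Proof.
intros H.
assert (H0 : g x = 0).
{ apply (is_derive_local_min (RInt g x) x (g x) d d_pos).
  - apply is_derive_RInt_cont, weighted_gap_continuous.
  - intros y Hy. rewrite RInt_point. now apply H. }
apply Rmult_integral in H0. specialize (p_pos x). lra.
Qed.

(** Left of [xh] the function is strictly decreasing, so just to the right of [x] it would drop
    below [f x = l] and make the integral negative. *)
Lemma RInt_local_min_unimodal :
  (forall y, Rabs (y - x) < d -> 0 <= RInt g x y) -> xh <= x.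
Proof.
intros H. assert (Heq := RInt_local_min_eq H).
destruct (Rle_or_lt xh x) as [|Hx]; [assumption|exfalso].
set (y := Rmin (x + d / 2) xh).
assert (Hy : x < y /\ y <= x + d / 2 /\ y <= xh).
{ unfold y. repeat split; [apply Rmin_glb_lt; lra | apply Rmin_l | apply Rmin_r]. }
assert (H0 := H y ltac:(apply Rabs_def1; lra)).
cut (RInt g x y < RInt (fun _ => 0) x y).
{ rewrite RInt_const. unfold scal; simpl; unfold mult; simpl. lra. }
apply RInt_lt; [lra| | |].
- intros; apply continuous_const.
- intros; apply weighted_gap_continuous.
- intros t Ht. unfold g. assert (Hp := p_pos t).
  assert (Hf : f t < f ((x + t) / 2)) by (apply (unimodal_decr _ _ f_unimodal); lra).
  assert (Hf' : f ((x + t) / 2) < f x) by (apply (unimodal_decr _ _ f_unimodal); lra).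
  rewrite <- Heq. assert (0 < (f x - f t) * p t) by (apply Rmult_lt_0_compat; lra).
  lra.
Qed.

End LocalOptimum.

Lemma unimodal_at_opp (f : R -> R) (xh : R) :
  unimodal_at f xh -> unimodal_at (fun t => f (- t)) (- xh).
Proof.
intros Hf. split.
- destruct (unimodal_min _ _ Hf) as [H1 H2]. split.
  + intros y. rewrite Ropp_involutive. apply H1.
  + intros y Hy. rewrite (H2 (- y)); [ring|].
    intros z. rewrite <- (Ropp_involutive z). apply (Hy (- z)).
- intros x y Hxy Hy. apply (unimodal_incr _ _ Hf); lra.
- intros x y Hx Hxy. apply (unimodal_decr _ _ Hf); lra.
Qed.

Lemma RInt_reflect (g : R -> R) (x y : R) :
  (forall t, continuous g t) ->
  RInt (fun t => g (- t)) (- x) (- y) = - RInt g x y :> R.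
Proof.
intros Hg. set (G := RInt g 0 : R -> R).
assert (HG : forall t, is_derive G t (g t)).
{ intros t. apply is_derive_RInt_cont, Hg. }
rewrite (RInt_is_derive G g x y HG Hg).
rewrite (RInt_is_derive (fun t => - G (- t)) (fun t => g (- t)) (- x) (- y)).
- rewrite !Ropp_involutive. ring.
- intros t. replace (g (- t)) with (- (- 1 * g (- t))) by ring.
  apply (is_derive_opp (fun t => G (- t))).
  apply (is_derive_comp G Ropp); [apply HG|].
  auto_derive; [exact I | ring].
- intros t. apply continuous_reflect, Hg.
Qed.

(** The reflection [t -> - t] flips the sign of the oriented integral and swaps the two branches of
    [f], which reduces the claim to the local minimum case. *)
Lemma RInt_local_max_unimodal (f p : R -> R) (l x xh d : R) :
  (forall t, continuous f t) -> (forall t, continuous p t) ->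
  (forall t, 0 < p t) -> unimodal_at f xh -> 0 < d ->
  (forall y, Rabs (y - x) < d -> RInt (fun t => (f t - l) * p t) x y <= 0) ->
  f x = l /\ x <= xh.
Proof.
intros Hf Hp Hpos Hxh Hd H.
assert (H' : forall y, Rabs (y - - x) < d ->
  0 <= RInt (fun t => (f (- t) - l) * p (- t)) (- x) y).
{ intros y Hy. rewrite <- (Ropp_involutive y).
  rewrite (RInt_reflect (fun t => (f t - l) * p t))
    by (intros; now apply weighted_gap_continuous).
  cut (RInt (fun t => (f t - l) * p t) x (- y) <= 0); [lra|].
  apply H. rewrite <- Rabs_Ropp. now replace (- (- y - x)) with (y - - x) by ring. }
split.
- rewrite <- (Ropp_involutive x).
  apply (RInt_local_min_eq (fun t => f (- t)) (fun t => p (- t)) l (- x) d);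
    auto using continuous_reflect.
- cut (- xh <= - x); [lra|].
  apply (RInt_local_min_unimodal (fun t => f (- t)) (fun t => p (- t)) l (- x) (- xh) d);
    auto using continuous_reflect, unimodal_at_opp.
Qed.

(** * Scale density, speed density and generator *)

Section Diffusion.

Variables (mu sigma : R -> R) (x0 : R).
Hypothesis mu_cont : forall x, continuous mu x.
Hypothesis Hsigma : diffusion_coefficient mu sigma.

Let s := scale_density mu sigma x0.
Let p := speed_density mu sigma x0.

Lemma sigma2_continuous (x : R) : continuous (fun y => sigma y ^ 2) x.
Proof.
apply (continuous_ext (fun y => sigma y * sigma y)); [intros; simpl; ring|].
apply (continuous_mult sigma sigma); apply (sigma_continuous _ _ Hsigma).
Qed.

Lemma sigma2_pos (x : R) : 0 < sigma x ^ 2.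
Proof. apply pow_lt, (sigma_pos _ _ Hsigma). Qed.

Lemma drift_ratio_continuous (x : R) :
  continuous (fun y => 2 * mu y / sigma y ^ 2) x.
Proof.
apply (continuous_mult (fun y => 2 * mu y) (fun y => / sigma y ^ 2)).
- apply (continuous_mult (fun _ => 2) mu); [apply continuous_const | apply mu_cont].
- apply continuous_Rinv_comp; [apply sigma2_continuous|].
  apply Rgt_not_eq, sigma2_pos.
Qed.

Lemma scale_density_pos (x : R) : 0 < s x.
Proof. apply exp_pos. Qed.

Lemma speed_density_pos (x : R) : 0 < p x.
Proof.
apply Rdiv_lt_0_compat; [lra|].
apply Rmult_lt_0_compat; [apply sigma2_pos | apply scale_density_pos].
Qed.

(** The reciprocal of the scale density is [exp (I x)] with [I' = 2 mu / sigma^2], and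
    [2 / (sigma^2 s)] is the speed density. *)
Lemma is_derive_inv_scale_density (x : R) :
  is_derive (fun y => / s y) x (mu x * p x).
Proof.
set (I := RInt (fun y => 2 * mu y / sigma y ^ 2) x0).
apply (is_derive_ext (fun y => exp (I y))).
{ intros y. unfold s, scale_density. fold (I y). now rewrite exp_Ropp, Rinv_inv. }
assert (HI := is_derive_RInt_cont _ x0 x drift_ratio_continuous).
fold I in HI.
assert (Hs := sigma2_pos x).
unfold p, speed_density, scale_density. fold (I x).
replace (mu x * (2 / (sigma x ^ 2 * exp (- I x))))
  with (2 * mu x / sigma x ^ 2 * exp (I x)).
- apply (is_derive_comp exp I); [|exact HI].
  apply is_derive_Reals, derivable_pt_lim_exp.
- rewrite exp_Ropp. assert (He := exp_pos (I x)). field. split; [lra|].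
  apply Rgt_not_eq, (sigma_pos _ _ Hsigma).
Qed.

Lemma speed_density_continuous (x : R) : continuous p x.
Proof.
apply (continuous_ext (fun y => 2 * (/ sigma y ^ 2 * / s y))).
{ intros y. unfold p, speed_density. fold (s y).
  assert (H := scale_density_pos y).
  change (2 * (/ sigma y ^ 2 * / s y) = 2 / (sigma y ^ 2 * s y) :> R). field.
  split; [lra | apply Rgt_not_eq, (sigma_pos _ _ Hsigma)]. }
apply (continuous_mult (fun _ => 2)); [apply continuous_const|].
apply (continuous_mult (fun y => / sigma y ^ 2) (fun y => / s y)).
- apply continuous_Rinv_comp; [apply sigma2_continuous|].
  apply Rgt_not_eq, sigma2_pos.
- apply (ex_derive_continuous (fun y => / s y)).
  eexists; apply is_derive_inv_scale_density.
Qed.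

Lemma mu_speed_continuous (x : R) : continuous (fun t => mu t * p t) x.
Proof. apply (continuous_mult mu p); [apply mu_cont | apply speed_density_continuous]. Qed.

Lemma RInt_mu_speed (a b : R) : RInt (fun t => mu t * p t) a b = / s b - / s a :> R.
Proof.
apply (RInt_is_derive (fun y => / s y)).
- apply is_derive_inv_scale_density.
- apply mu_speed_continuous.
Qed.

Lemma speed_measure_pos (a b : R) : a < b -> 0 < speed_measure mu sigma x0 a b.
Proof.
intros Hab. apply RInt_gt_0; [assumption| |]; intros.
- apply speed_density_pos.
- apply speed_density_continuous.
Qed.

Lemma generator_continuous (v : R -> R) (x : R) :
  C2 v -> continuous (generator mu sigma v) x.
Proof.
intros Hv. destruct (Hv x) as [_ [H2 H3]].
apply (continuous_plus (fun x => 1 / 2 * sigma x ^ 2 * Derive_n v 2 x)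
                       (fun x => mu x * Derive v x)).
- apply (continuous_mult (fun x => 1 / 2 * sigma x ^ 2) (Derive_n v 2)); [|assumption].
  apply (continuous_mult (fun _ => 1 / 2)); [apply continuous_const|].
  apply sigma2_continuous.
- apply (continuous_mult mu (Derive v)); [apply mu_cont|].
  apply (ex_derive_continuous (Derive v)), H2.
Qed.

Lemma generator_speed_continuous (v : R -> R) (x : R) :
  C2 v -> continuous (fun t => generator mu sigma v t * p t) x.
Proof.
intros Hv. apply (continuous_mult (generator mu sigma v) p).
- now apply generator_continuous.
- apply speed_density_continuous.
Qed.

(** The integrand is the derivative of [v' / s]: the product rule yields [v'' / s + v' mu p], and
    [1 / s = sigma^2 p / 2]. *)
Lemma RInt_generator (v : R -> R) (a b : R) : C2 v ->
  RInt (fun t => generator mu sigma v t * p t) a b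
  = Derive v b / s b - Derive v a / s a :> R.
Proof.
intros Hv. apply (RInt_is_derive (fun t => Derive v t / s t)).
2: intros; now apply generator_speed_continuous.
intros x. destruct (Hv x) as [_ [H2 _]].
replace (generator mu sigma v x * p x)
  with (Derive_n v 2 x * / s x + Derive v x * (mu x * p x)).
- apply (is_derive_mult (Derive v) (fun t => / s t)).
  + apply (Derive_correct (Derive v) x H2).
  + apply is_derive_inv_scale_density.
  + exact Rmult_comm.
- unfold generator, p, speed_density. fold (s x).
  assert (H := scale_density_pos x). field.
  split; [lra | apply Rgt_not_eq, (sigma_pos _ _ Hsigma)].
Qed.

(** * Excess of the cost over a given rate *)

Section Cost.

Variables (c : R -> R) (qu qd : R).
Hypothesis c_cont : forall x, continuous c x.

(** This is the average cost minus [l], multiplied by the speed measure of the interval. It has the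
    sign of that difference, and clearing the denominator makes it additive when a boundary
    moves. *)
Definition excess (l a b : R) : R :=
  RInt (fun t => (c t - l) * p t) a b + qu / s a + qd / s b.

Lemma excess_continuous (l x : R) : continuous (fun t => (c t - l) * p t) x.
Proof. apply weighted_gap_continuous; [apply c_cont | apply speed_density_continuous]. Qed.

Lemma excess_avg_cost (l a b : R) : a < b ->
  excess l a b
  = (avg_cost mu sigma c qu qd x0 a b - l) * speed_measure mu sigma x0 a b.
Proof.
intros Hab. assert (HM := speed_measure_pos a b Hab).
unfold avg_cost. fold p. fold (s a) (s b).
assert (H : RInt (fun t => (c t - l) * p t) a b
  = RInt (fun t => c t * p t) a b - l * speed_measure mu sigma x0 a b :> R).
{ rewrite (RInt_ext _ (fun t => c t * p t + - l * p t)) by (intros; simpl; ring).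
  rewrite (RInt_plus_cont (fun t => c t * p t) (fun t => - l * p t)).
  - rewrite (RInt_scal_cont (- l) p) by exact speed_density_continuous.
    unfold speed_measure. fold p. ring.
  - intros t. apply (continuous_mult c p); [apply c_cont | apply speed_density_continuous].
  - intros t. apply (continuous_scal_r (- l) p), speed_density_continuous. }
assert (Ha := scale_density_pos a). assert (Hb := scale_density_pos b).
unfold excess. rewrite H. field. repeat split; lra.
Qed.

(** The drift part integrates to increments of [1 / s], the form of the reflection costs. The cases
    [q = qd] and [q = - qu] give [pi1] and [pi2]. *)
Lemma RInt_pi (q l a b : R) :
  RInt (fun t => ((c t + q * mu t) - l) * p t) a b
  = RInt (fun t => (c t - l) * p t) a b + q * (/ s b - / s a) :> R.
Proof.
rewrite <- RInt_mu_speed.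
rewrite (RInt_ext _ (fun t => (c t - l) * p t + q * (mu t * p t)))
  by (intros; simpl; ring).
rewrite (RInt_plus_cont (fun t => (c t - l) * p t) (fun t => q * (mu t * p t))).
- rewrite (RInt_scal_cont q (fun t => mu t * p t)) by exact mu_speed_continuous.
  reflexivity.
- apply excess_continuous.
- intros t. apply (continuous_scal_r q (fun t => mu t * p t)), mu_speed_continuous.
Qed.

Lemma excess_move_right (l a b y : R) :
  excess l a y = excess l a b + RInt (fun t => (pi1 mu c qd t - l) * p t) b y.
Proof.
unfold pi1. rewrite RInt_pi. unfold excess.
rewrite <- (RInt_Chasles_cont (fun t => (c t - l) * p t) a b y)
  by apply excess_continuous.
unfold Rdiv. ring.
Qed.

Lemma excess_move_left (l a b y : R) :
  excess l y b = excess l a b - RInt (fun t => (pi2 mu c qu t - l) * p t) a y.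
Proof.
rewrite (RInt_ext _ (fun t => ((c t + - qu * mu t) - l) * p t))
  by (intros; unfold pi2; simpl; ring).
rewrite RInt_pi. unfold excess.
rewrite <- (RInt_Chasles_cont (fun t => (c t - l) * p t) a y b)
  by apply excess_continuous.
unfold Rdiv. ring.
Qed.

Section Optimal.

Variables a b : R.
Hypothesis Hopt : optimal_boundaries mu sigma c qu qd x0 a b.

Let l := avg_cost mu sigma c qu qd x0 a b.

Lemma excess_optimal : excess l a b = 0.
Proof. destruct Hopt as [Hab _]. rewrite excess_avg_cost by assumption. unfold l. ring. Qed.

Lemma excess_optimal_ge_0 (a' b' : R) : a' < b' -> 0 <= excess l a' b'.
Proof.
intros Hab'. rewrite excess_avg_cost by assumption.
apply Rmult_le_pos.
- destruct Hopt as [_ H]. specialize (H a' b' Hab'). unfold l. lra.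
- apply Rlt_le, speed_measure_pos, Hab'.
Qed.

Lemma optimal_right (xh : R) : unimodal_at (pi1 mu c qd) xh ->
  pi1 mu c qd b = l /\ xh <= b.
Proof.
intros Hxh. destruct Hopt as [Hab _].
(* A point closer to [b] than [b - a] stays to the right of [a], so moving [b] there gives an
   admissible competitor. *)
assert (Hd : 0 < b - a) by lra.
assert (Hc : forall t, continuous (pi1 mu c qd) t).
{ intros t. apply (continuous_plus c (fun x => qd * mu x)); [apply c_cont|].
  apply (continuous_scal_r qd mu), mu_cont. }
assert (H : forall y, Rabs (y - b) < b - a ->
  0 <= RInt (fun t => (pi1 mu c qd t - l) * p t) b y).
{ intros y Hy. apply Rabs_def2 in Hy.
  assert (H := excess_optimal_ge_0 a y ltac:(lra)).
  rewrite (excess_move_right l a b y), excess_optimal in H. lra. }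
split.
- apply (RInt_local_min_eq _ p l b (b - a)); auto using speed_density_continuous, speed_density_pos.
- apply (RInt_local_min_unimodal (pi1 mu c qd) p l b xh (b - a)); auto using speed_density_continuous, speed_density_pos.
Qed.

Lemma optimal_left (xh : R) : unimodal_at (pi2 mu c qu) xh ->
  pi2 mu c qu a = l /\ a <= xh.
Proof.
intros Hxh. destruct Hopt as [Hab _].
(* Moving the left boundary subtracts the integral from the excess, so here the integral has a local
   maximum. *)
apply (RInt_local_max_unimodal _ p l a xh (b - a));
  auto using speed_density_continuous, speed_density_pos; try lra.
- intros t. apply (continuous_minus c (fun x => qu * mu x)); [apply c_cont|].
  apply (continuous_scal_r qu mu), mu_cont.
- intros y Hy. apply Rabs_def2 in Hy.
  assert (H := excess_optimal_ge_0 y b ltac:(lra)).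
  rewrite (excess_move_left l a b y), excess_optimal in H. lra.
Qed.

End Optimal.

(** Adding the generator term to the integrand contributes the boundary values of [v' / s], which
    the changed boundary coefficients cancel. *)
Lemma excess_generator (v : R -> R) (l a b : R) : C2 v ->
  excess l a b
  = RInt (fun t => (generator mu sigma v t + c t - l) * p t) a b
    + (qu + Derive v a) / s a + (qd - Derive v b) / s b.
Proof.
intros Hv.
rewrite (RInt_ext _ (fun t => generator mu sigma v t * p t + (c t - l) * p t))
  by (intros; simpl; ring).
rewrite (RInt_plus_cont
  (fun t => generator mu sigma v t * p t) (fun t => (c t - l) * p t)).
- rewrite RInt_generator by assumption. unfold excess, Rdiv. ring.
- intros; now apply generator_speed_continuous.
- apply excess_continuous.
Qed.

End Cost.
End Diffusion.

(** * The value function as a supersolution, and its use for a larger volatility *)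

Section Value.

Variables (mu sigma c v : R -> R) (qu qd x0 a b : R).
Hypothesis Hstd : standing_assumptions mu c qu qd.
Hypothesis Hsigma : diffusion_coefficient mu sigma.
Hypothesis Hopt : optimal_boundaries mu sigma c qu qd x0 a b.

Let l := avg_cost mu sigma c qu qd x0 a b.

Hypothesis Hv : value_function mu sigma c qu qd a b l v.

Lemma value_Derive_right (x : R) : b < x -> Derive v x = qd.
Proof.
intros Hx. apply is_derive_unique.
apply (is_derive_ext_loc (fun x => qd * (x - b) + v b)).
- apply (filter_imp (fun y => b < y)); [|exact (open_gt b x Hx)].
  intros y Hy. symmetry. apply (value_right _ _ _ _ _ _ _ _ _ Hv). lra.
- auto_derive; [exact I | ring].
Qed.

Lemma value_Derive_left (x : R) : x < a -> Derive v x = - qu.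
Proof.
intros Hx. apply is_derive_unique.
apply (is_derive_ext_loc (fun x => qu * (a - x) + v a)).
- apply (filter_imp (fun y => y < a)); [|exact (open_lt a x Hx)].
  intros y Hy. symmetry. apply (value_left _ _ _ _ _ _ _ _ _ Hv). lra.
- auto_derive; [exact I | ring].
Qed.

Lemma value_Derive2_right (x : R) : b < x -> Derive_n v 2 x = 0.
Proof.
intros Hx. change (Derive (Derive v) x = 0).
rewrite <- (Derive_const qd x). apply Derive_ext_loc.
apply (filter_imp (fun y => b < y)); [|exact (open_gt b x Hx)].
exact value_Derive_right.
Qed.

Lemma value_Derive2_left (x : R) : x < a -> Derive_n v 2 x = 0.
Proof.
intros Hx. change (Derive (Derive v) x = 0).
rewrite <- (Derive_const (- qu) x). apply Derive_ext_loc.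
apply (filter_imp (fun y => y < a)); [|exact (open_lt a x Hx)].
exact value_Derive_left.
Qed.

(** Right of [b], where [v] is affine with slope [qd], the expression is [pi1 - l]; left of [a] it
    is [pi2 - l]. Both are nonnegative because they vanish at the optimal boundary and grow outwards
    from it. Inside, the equation gives zero. *)
Lemma value_supersolution (x : R) : 0 <= generator mu sigma v x + c x - l.
Proof.
assert (Hmu := mu_continuous _ _ _ _ Hstd).
assert (Hc := c_continuous _ _ _ _ Hstd).
set (F := fun x => generator mu sigma v x + c x - l).
assert (HF : forall x, continuous F x).
{ intros y. apply (continuous_minus (fun x => generator mu sigma v x + c x) (fun _ => l)).
  - apply (continuous_plus (generator mu sigma v) c); [|apply Hc].
    apply generator_continuous; auto. apply (value_C2 _ _ _ _ _ _ _ _ _ Hv).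
  - apply continuous_const. }
assert (Hr : forall y, b < y -> 0 <= F y).
{ intros y Hy. destruct (pi1_unimodal _ _ _ _ Hstd) as [xh Hxh].
  destruct (optimal_right mu sigma x0 Hmu Hsigma c qu qd Hc a b Hopt xh Hxh) as [Heq Hle].
  fold l in Heq. assert (H := unimodal_le_right _ _ b y Hxh Hle ltac:(lra)).
  unfold F, generator. rewrite value_Derive2_right, value_Derive_right by assumption.
  unfold pi1 in *. lra. }
assert (Hl : forall y, y < a -> 0 <= F y).
{ intros y Hy. destruct (pi2_unimodal _ _ _ _ Hstd) as [xh Hxh].
  destruct (optimal_left mu sigma x0 Hmu Hsigma c qu qd Hc a b Hopt xh Hxh) as [Heq Hle].
  fold l in Heq. assert (H := unimodal_le_left _ _ y a Hxh Hle ltac:(lra)).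
  unfold F, generator. rewrite value_Derive2_left, value_Derive_left by assumption.
  unfold pi2 in *. lra. }
change (0 <= F x).
destruct (Rlt_or_le x a) as [Ha | [Ha | <-]]; [now apply Hl | |].
(* The endpoints follow by continuity from outside, since [v] is [C2]. *)
2: now apply continuous_ge_0_left.
destruct (Rlt_or_le b x) as [Hb | [Hb | ->]]; [now apply Hr | |].
2: now apply continuous_ge_0_right.
unfold F. rewrite (value_ode _ _ _ _ _ _ _ _ _ Hv x) by lra. lra.
Qed.

Hypothesis Hconvex : convex v.

Lemma value_Derive_bounds (x : R) : - qu <= Derive v x <= qd.
Proof.
assert (Hd : forall x, ex_derive v x).
{ intros y. apply (value_C2 _ _ _ _ _ _ _ _ _ Hv). }
split.
(* The comparison point lies at or left of [x] and strictly left of [a], where the slope is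
   [- qu]. *)
- rewrite <- (value_Derive_left (Rmin x (a - 1))).
  + apply convex_Derive_incr; auto. apply Rmin_l.
  + assert (H := Rmin_r x (a - 1)). lra.
- rewrite <- (value_Derive_right (Rmax x (b + 1))).
  + apply convex_Derive_incr; auto. apply Rmax_l.
  + assert (H := Rmax_r x (b + 1)). lra.
Qed.

Variable sigmahat : R -> R.
Hypothesis Hsigmahat : diffusion_coefficient mu sigmahat.
Hypothesis Hlt : forall x, sigma x < sigmahat x.

Lemma excess_larger_volatility_pos (a' b' : R) : a' < b' ->
  0 < excess mu sigmahat x0 c qu qd l a' b'.
Proof.
intros Hab.
assert (Hmu := mu_continuous _ _ _ _ Hstd).
assert (Hc := c_continuous _ _ _ _ Hstd).
assert (HC2 := value_C2 _ _ _ _ _ _ _ _ _ Hv).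
set (p := speed_density mu sigmahat x0).
(* Weight of [v''] in the difference of the two generators, taken against the speed density of
   [sigmahat]. *)
set (k := fun t => 1 / 2 * (sigmahat t ^ 2 - sigma t ^ 2) * p t).
assert (Hp : forall t, 0 < p t) by now apply speed_density_pos.
assert (Hpc : forall t, continuous p t) by now apply speed_density_continuous.
assert (Hkpos : forall t, 0 < k t).
{ intros t. apply Rmult_lt_0_compat; [|apply Hp].
  assert (Hs := sigma_pos _ _ Hsigma t). assert (Hlt' := Hlt t).
  assert (0 < (sigmahat t - sigma t) * (sigmahat t + sigma t))
    by (apply Rmult_lt_0_compat; lra).
  simpl. lra. }
assert (Hkc : forall t, continuous k t).
{ intros t.
  apply (continuous_mult (fun t => 1 / 2 * (sigmahat t ^ 2 - sigma t ^ 2)) p);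
    [|apply Hpc].
  apply (continuous_scal_r (1 / 2) (fun t => sigmahat t ^ 2 - sigma t ^ 2)).
  apply (continuous_minus (fun t => sigmahat t ^ 2) (fun t => sigma t ^ 2));
    eapply sigma2_continuous; eassumption. }
(* A positive lower bound [k t0] on the weight can be pulled out, leaving the integral of [v''], the
   increment of [v']. *)
destruct (continuity_ab_min k a' b') as [t0 [Hmin _]]; [lra| |].
{ intros t _. apply continuity_pt_filterlim, Hkc. }
assert (Hd : forall x, ex_derive v x) by apply HC2.
assert (Hd2 : forall x, ex_derive (Derive v) x) by apply HC2.
assert (Hint : k t0 * (Derive v b' - Derive v a')
  <= RInt (fun t => (generator mu sigmahat v t + c t - l) * p t) a' b').
{ assert (HD : RInt (Derive_n v 2) a' b' = Derive v b' - Derive v a' :> R).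
  { apply RInt_is_derive; [|apply HC2].
    intros t. apply (Derive_correct (Derive v) t), Hd2. }
  rewrite <- HD.
  rewrite <- (RInt_scal_cont (k t0) (Derive_n v 2)) by apply HC2.
  apply RInt_le; [lra| | |].
  - apply ex_RInt_cont. intros t. apply (continuous_scal_r (k t0) (Derive_n v 2)), HC2.
  - apply ex_RInt_cont.
    apply (weighted_gap_continuous (fun t => generator mu sigmahat v t + c t));
      [|assumption].
    intros t. apply (continuous_plus (generator mu sigmahat v) c); [|apply Hc].
    now apply generator_continuous.
  - intros t Ht.
    assert (H0 := Rmult_le_pos _ _ (value_supersolution t) (Rlt_le _ _ (Hp t))).
    assert (H1 := convex_Derive2_ge_0 v Hd Hconvex t (Hd2 t)).
    assert (H2 := Rmult_le_compat_r _ _ _ H1 (Hmin t ltac:(lra))).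
    replace ((generator mu sigmahat v t + c t - l) * p t)
      with ((generator mu sigma v t + c t - l) * p t + k t * Derive_n v 2 t)
      by (unfold k, generator; ring).
    change (k t0 * Derive_n v 2 t
      <= (generator mu sigma v t + c t - l) * p t + k t * Derive_n v 2 t).
    lra. }
rewrite (excess_generator mu sigmahat x0 Hmu Hsigmahat c qu qd Hc v l a' b' HC2).
fold p.
assert (Hk := Hkpos t0).
assert (Ha := value_Derive_bounds a'). assert (Hb := value_Derive_bounds b').
assert (Hm := convex_Derive_incr v Hd Hconvex a' b' ltac:(lra)).
assert (Hq := qu_qd_pos _ _ _ _ Hstd).
assert (Hsa := Rinv_0_lt_compat _ (scale_density_pos mu sigmahat x0 a')).
assert (Hsb := Rinv_0_lt_compat _ (scale_density_pos mu sigmahat x0 b')).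
unfold Rdiv.
set (r := / scale_density mu sigmahat x0 a') in *.
set (r' := / scale_density mu sigmahat x0 b') in *.
assert (H1 : 0 <= k t0 * (Derive v b' - Derive v a')) by (apply Rmult_le_pos; lra).
assert (H2 : 0 <= (qu + Derive v a') * r) by (apply Rmult_le_pos; lra).
assert (H3 : 0 <= (qd - Derive v b') * r') by (apply Rmult_le_pos; lra).
(* One of three terms must be strictly positive: if [v'] does not increase and [v'(a')] equals
   [- qu], then [v'(b')] is at most [- qu < qd]. *)
destruct (Rlt_or_le (Derive v a') (Derive v b')) as [Hl|Hl].
- assert (0 < k t0 * (Derive v b' - Derive v a')) by (apply Rmult_lt_0_compat; lra).
  lra.
- destruct (Rlt_or_le (- qu) (Derive v a')) as [Hl'|Hl'].
  + assert (0 < (qu + Derive v a') * r) by (apply Rmult_lt_0_compat; lra). lra.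
  + assert (0 < (qd - Derive v b') * r') by (apply Rmult_lt_0_compat; lra). lra.
Qed.

End Value.

(** * Comparison of the rates, then of the boundaries *)

Theorem lemma2p6 (mu c sigma sigmahat : R -> R) (qu qd x0 : R)
  (Hstd : standing_assumptions mu c qu qd)
  (Hsigma : diffusion_coefficient mu sigma)
  (Hsigmahat : diffusion_coefficient mu sigmahat)
  (Hlt : forall x, sigma x < sigmahat x)
  (astar bstar lambdastar : R) (v : R -> R)
  (Hopt : optimal_boundaries mu sigma c qu qd x0 astar bstar)
  (Hlambda : lambdastar = avg_cost mu sigma c qu qd x0 astar bstar)
  (Hv : value_function mu sigma c qu qd astar bstar lambdastar v)
  (acheck bcheck lambdahat : R)
  (Hopthat : optimal_boundaries mu sigmahat c qu qd x0 acheck bcheck)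
  (Hlambdahat : lambdahat = avg_cost mu sigmahat c qu qd x0 acheck bcheck)
  (Hconvex : convex v) :
  acheck < astar /\ bstar < bcheck /\ lambdastar < lambdahat.
Proof.
assert (Hmu := mu_continuous _ _ _ _ Hstd).
assert (Hc := c_continuous _ _ _ _ Hstd).
assert (Hcost : lambdastar < lambdahat).
{ subst lambdastar. destruct Hopthat as [Hab _].
  assert (H := excess_larger_volatility_pos mu sigma c v qu qd x0 astar bstar
    Hstd Hsigma Hopt Hv Hconvex sigmahat Hsigmahat Hlt acheck bcheck Hab).
  (* At the optimum of the second model the excess over [lambdastar] is [lambdahat - lambdastar]
     times a positive speed measure. *)
  rewrite excess_avg_cost, <- Hlambdahat in H by assumption.
  assert (HM := speed_measure_pos mu sigmahat x0 Hmu Hsigmahat _ _ Hab).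
  apply (Rmult_lt_reg_r (speed_measure mu sigmahat x0 acheck bcheck)); lra. }
destruct (pi1_unimodal _ _ _ _ Hstd) as [xh1 Hxh1].
destruct (pi2_unimodal _ _ _ _ Hstd) as [xh2 Hxh2].
destruct (optimal_right mu sigma x0 Hmu Hsigma c qu qd Hc _ _ Hopt xh1 Hxh1) as [Eb _].
destruct (optimal_right mu sigmahat x0 Hmu Hsigmahat c qu qd Hc _ _ Hopthat xh1 Hxh1)
  as [Ebc Lbc].
destruct (optimal_left mu sigma x0 Hmu Hsigma c qu qd Hc _ _ Hopt xh2 Hxh2) as [Ea _].
destruct (optimal_left mu sigmahat x0 Hmu Hsigmahat c qu qd Hc _ _ Hopthat xh2 Hxh2)
  as [Eac Lac].
repeat split; [| |assumption]; apply Rnot_le_lt; intros Hle.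
(* If [astar <= acheck <= xh2], then [pi2] at [acheck] is at most its value at [astar], that is
   [lambdahat <= lambdastar], a contradiction. The right boundary is symmetric with [pi1]. *)
- assert (H := unimodal_le_left _ _ _ _ Hxh2 Lac Hle). lra.
- assert (H := unimodal_le_right _ _ _ _ Hxh1 Lbc Hle). lra.
Qed.
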